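(* Let $r\ge 2$ be an integer, and let $0<p_i<1$ for $i\in[r]$. Let $q_0:=\max_{i\in[r]}p_i$, $L_i:=-\log p_i$ and $L:=\sum_{i=1}^r L_i$. Suppose that $$s:=\left\lceil\frac{1}{1-q_0}\right\rceil\le r\qquad\text{and}\qquad \max_{i\in[r]}L_i\le\frac{L}{s}.$$ Then every $r$-cross-intersecting tuple $\mathcal F_1,\dots,\mathcal F_r\subseteq 2^{[n]}$ satisfies $$\prod_{i=1}^r\mu_{p_i}(\mathcal F_i)\le\prod_{i=1}^r p_i.$$
   Context: $[n]=\{1,\dots,n\}$ and $2^{[n]}$ is its power set. For $0\le p\le 1$ and $\mathcal F\subseteq 2^{[n]}$, the $p$-biased measure is $\mu_p(\mathcal F)=\sum_{F\in\mathcal F}p^{|F|}(1-p)^{n-|F|}$. Families $\mathcal F_1,\dots,\mathcal F_r\subseteq 2^{[n]}$ are $r$-cross-intersecting if $A_1\cap\cdots\cap A_r\neq\varnothing$ for every choice of $A_i\in\mathcal F_i$, $i\in[r]$ (vacuously true if some $\mathcal F_i$ is empty). *)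

(* Defs.v *)
From mathcomp Require Import all_boot all_order all_algebra.
From mathcomp Require Import reals exp.

Set Implicit Arguments.
Unset Strict Implicit.
Unset Printing Implicit Defensive.

Import Order.TTheory GRing.Theory Num.Theory.
Local Open Scope ring_scope.

Definition biased_measure (R : realType) (n : nat) (p : R)
    (F : {set {set 'I_n}}) : R :=
  \sum_(A in F) p ^+ #|A| * (1 - p) ^+ (n - #|A|).

Definition cross_intersecting (n r : nat) (F : 'I_r -> {set {set 'I_n}}) : Prop :=
  forall A : 'I_r -> {set 'I_n},
    (forall i, A i \in F i) -> \bigcap_(i < r) A i != set0.

(* Maximum of a finite family.  The seed 0 is harmless only for nonempty
   families of nonnegative reals. *)
Definition fam_max (R : realType) (r : nat) (x : 'I_r -> R) : R :=
  \big[Num.max/0]_(i < r) x i.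

(* Main.v *)
(* We may replace each [F i] by its up-closure. For an up-closed family,
   [log_p (mu_p F)] is nonincreasing in [p]: a coordinate-by-coordinate
   induction reduces this to a two-point inequality for the concave function
   [t |-> t ^ a]. Since every [p i <= q := 1 - 1/s], it suffices to bound the
   numbers [a i := log_q (mu_q (F i))].
   At bias [q], throw each point of [n] independently and uniformly into one of
   [s] classes; the complements of the classes are [s] sets of distribution
   [mu_q] with empty intersection, so for any [s] of the families the measures
   [mu_q (F i)] sum to at most [s - 1] and, by AM-GM, their [a i] sum to at
   least [s]. As the weights [L_ i] are at most [L / s], the bound on the [s]
   smallest [a i] gives [\sum_i a i * L_ i >= L], which is the theorem. *)
Require Import Defs.
From mathcomp Require Import all_boot all_order all_algebra.
From mathcomp Require Import reals exp.
From mathcomp Require Import ring lra interval_inference convex sequences.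

Import Order.TTheory GRing.Theory Num.Theory.
Local Open Scope ring_scope.

(** * Concavity of powers with exponent in [(0, 1]] *)

Lemma powR_le_tangent {R : realType} (t a : R) :
  0 <= t -> 0 < a <= 1 -> t `^ a <= a * t + (1 - a).
Proof.
move=> t0 /andP[a0 a1]; have [->|tN0] := eqVneq t 0.
  by rewrite powR0 ?gt_eqF// mulr0 add0r subr_ge0.
have tp : 0 < t by rewrite lt_neqAle eq_sym tN0.
have := @convex_expR R (Itv01 (ltW a0) a1) (ln t) 0.
rewrite !convRE /= expR0 lnK ?posrE// mulr0 addr0 mulr1.
by rewrite /powR gt_eqF.
Qed.

(** The tangent bound at 1, rescaled to the mean [m], puts the power function below an affine
    function with equality at [m]; average it over [x] and [y]. *)
Lemma powR_concave {R : realType} (a l x y : R) : 0 < a <= 1 -> 0 <= l <= 1 ->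
  0 <= x -> 0 <= y ->
  l * x `^ a + (1 - l) * y `^ a <= (l * x + (1 - l) * y) `^ a.
Proof.
move=> a01 /andP[l0 l1] x0 y0; set m := l * x + _.
have lx : 0 <= l * x by rewrite mulr_ge0.
have ly : 0 <= (1 - l) * y by rewrite mulr_ge0// subr_ge0.
have aN0 : a != 0 by case/andP: a01 => a0 _; rewrite gt_eqF.
have m0 : 0 <= m by exact: addr_ge0.
have [mE|mN0] := eqVneq m 0.
  move/eqP: mE; rewrite paddr_eq0// !mulf_eq0.
  by case/andP=> /orP[]/eqP -> /orP[]/eqP ->;
    rewrite ?(powR0 aN0) ?mulr0 ?mul0r ?addr0 powR_ge0.
have mp : 0 < m by rewrite lt_neqAle eq_sym mN0.
have H z : 0 <= z -> z `^ a <= m `^ a * (a * (z / m) + (1 - a)).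
  move=> z0; rewrite -{1}(divfK mN0 z) powRM ?divr_ge0// mulrC.
  by rewrite ler_wpM2l ?powR_ge0// powR_le_tangent// divr_ge0.
have l1' : 0 <= 1 - l by rewrite subr_ge0.
apply: le_trans (lerD (ler_wpM2l l0 (H x x0)) (ler_wpM2l l1' (H y y0))) _.
rewrite le_eqVlt; apply/orP; left; apply/eqP.
have mE : l * (x / m) + (1 - l) * (y / m) = 1 by rewrite !mulrA -mulrDl divff.
rewrite -[RHS]mulr1 !(mulrCA _ (m `^ a)) -mulrDr; congr (_ * _).
by rewrite [LHS](_ : _ = a * (l * (x / m) + (1 - l) * (y / m)) + (1 - a));
  [rewrite mE; ring | ring].
Qed.

(** Both [q * x] and [y] lie between [q * y] and [w], and [q * x + y = w + q * y]; by concavity the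
    inner pair has the larger sum of powers. *)
Lemma powR_two_point {R : realType} (a q x y : R) : 0 < a <= 1 -> 0 <= q <= 1 ->
  0 <= y <= x ->
  (q * x + (1 - q) * y) `^ a <= q `^ a * x `^ a + (1 - q `^ a) * y `^ a.
Proof.
move=> a01 /andP[q0 q1] /andP[y0 yx]; have x0 := le_trans y0 yx.
have q1' : 0 <= 1 - q by rewrite subr_ge0.
set w := q * x + _.
have qyx : q * y <= q * x by rewrite ler_wpM2l.
have wy : y <= w by rewrite /w -[leLHS](subrK (q * y)); lra.
have qyy : q * y <= y by rewrite ler_piMl.
have w0 : 0 <= w by exact: le_trans wy.
have qy0 : 0 <= q * y by rewrite mulr_ge0.
rewrite mulrBl mul1r -!powRM//.
have [wE|wN] := eqVneq w (q * y).
  have yE : y = q * y by lra.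
  have -> : w = y by lra.
  rewrite -yE.
  have : y `^ a <= (q * x) `^ a.
    by rewrite ge0_ler_powR ?nnegrE ?mulr_ge0//; [case/andP: a01=> /ltW | lra].
  lra.
have d0 : 0 < w - q * y by rewrite subr_gt0 lt_neqAle eq_sym wN /=; lra.
(* [q * x] sits at parameter [l] between [q * y] and [w], and [y] at [1 - l]. *)
pose l := (q * x - q * y) / (w - q * y).
have l0 : 0 <= l by rewrite divr_ge0// ?(ltW d0)// subr_ge0.
have l1 : l <= 1 by rewrite ler_pdivrMr// mul1r /w; lra.
have lE : l * (w - q * y) = q * x - q * y by rewrite divfK// gt_eqF.
have H1 := @powR_concave R a l w (q * y) a01 _ w0 qy0.
have H2 := @powR_concave R a (1 - l) w (q * y) a01 _ w0 qy0.
have E1 : l * w + (1 - l) * (q * y) = q * x by lra.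
have E2 : (1 - l) * w + (1 - (1 - l)) * (q * y) = y by rewrite /w in lE *; lra.
move: H1 H2; rewrite E1 E2 => H1 H2.
have {}H1 := H1 ltac:(lra); have {}H2 := H2 ltac:(lra).
by lra.
Qed.

(** * Means over biased random subsets *)

Section BiasedMean.
Context {R : realType} {T : finType}.
Implicit Types (p : R) (D A B : {set T}) (f : {set T} -> R).

(** For [p] in [[0, 1]], the expectation of [f] at a random subset of [D] keeping each point with
    probability [p]. A general [D] allows induction one point at a time. *)
Definition bmean p D f : R :=
  \sum_(B in powerset D) p ^+ #|B| * (1 - p) ^+ (#|D| - #|B|) * f B.

Lemma bmean0 p f : bmean p set0 f = f set0.
Proof.
by rewrite /bmean powerset0 big_set1 cards0 subnn !expr0 !mul1r.
Qed.

(** Condition on whether the random subset contains [x]. *)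
Lemma bmeanU1 p D f x : x \notin D ->
  bmean p (x |: D) f = p * bmean p D (fun B => f (x |: B)) + (1 - p) * bmean p D f.
Proof.
move=> xD; rewrite /bmean (bigID (fun B : {set T} => x \in B)) /=; congr (_ + _).
  rewrite (reindex_onto (fun B => x |: B) (fun B => B :\ x)) /=; last first.
    by move=> B /andP[_ xB]; rewrite setD1K.
  rewrite big_distrr /=.
  have PE B : (x |: B \in powerset (x |: D)) && (x \in x |: B) && ((x |: B) :\ x == B)
      = (B \in powerset D).
    rewrite setU11 andbT !powersetE; apply/andP/idP => [[BD /eqP <-]|BD].
      by rewrite subDset.
    have xB : x \notin B by apply: contra xD; apply: (subsetP BD).
    by rewrite setUS// setU1K.
  apply: eq_big => B; first exact: PE.
  rewrite PE powersetE => BD.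
  have xB : x \notin B by apply: contra xD; apply: (subsetP BD).
  by rewrite !cardsU1 xB xD /= !add1n subSS exprS -!mulrA.
rewrite big_distrr /=; apply: eq_big => B.
  rewrite !powersetE; apply/andP/idP => [[BD xB]|BD].
    apply/subsetP => y yB; move/subsetP: BD => /(_ y yB).
    by rewrite in_setU1 => /predU1P[yx|//]; rewrite -yx yB in xB.
  split; first by rewrite (subset_trans BD)// subsetUr.
  by apply: contra xD; apply: (subsetP BD).
rewrite powersetE => /andP[BD xB].
have {}BD : B \subset D.
  apply/subsetP => y yB; move/subsetP: BD => /(_ y yB).
  by rewrite in_setU1 => /predU1P[yx|//]; rewrite -yx yB in xB.
rewrite cardsU1 xD add1n subSn ?subset_leq_card// exprS; ring.
Qed.

Lemma bmean_ge0 p D f : 0 <= p <= 1 -> (forall B, 0 <= f B) -> 0 <= bmean p D f.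
Proof.
move=> /andP[p0 p1] f0; apply: sumr_ge0 => B _.
by rewrite !mulr_ge0// exprn_ge0// subr_ge0.
Qed.

Lemma ler_bmean p D f g : 0 <= p <= 1 -> (forall B, f B <= g B) ->
  bmean p D f <= bmean p D g.
Proof.
move=> /andP[p0 p1] fg; apply: ler_sum => B _.
by rewrite ler_wpM2l// mulr_ge0// exprn_ge0// subr_ge0.
Qed.

Lemma setU1_ind (P : {set T} -> Prop) :
  P set0 -> (forall x D, x \notin D -> P D -> P (x |: D)) -> forall D, P D.
Proof.
move=> P0 PU D; have [n] := ubnP #|D|; elim: n D => // n IH D Dn.
have [->//|[x xD]] := set_0Vmem D.
rewrite -(setD1K xD); apply: PU; first by rewrite setD11.
by apply: IH; rewrite (cardsD1 x D) xD in Dn.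
Qed.

(** Condition on one point at a time: monotonicity of [f] orders the two conditional means as
    [powR_two_point] requires, and induction handles each of them. *)
Lemma powR_bmean_le p (a : R) D f : 0 <= p <= 1 -> 0 < a <= 1 ->
  (forall B, 0 <= f B) -> (forall A B, A \subset B -> f A <= f B) ->
  bmean p D f `^ a <= bmean (p `^ a) D (fun B => f B `^ a).
Proof.
move=> p01 a01; elim/setU1_ind: D f => [f|x D xD IH f] f0 fmono.
  by rewrite !bmean0.
have [p0 p1] := andP p01; have [a0 a1] := andP a01.
have pa0 : 0 <= p `^ a := powR_ge0 _ _.
have pa1 : p `^ a <= 1.
  by have := ge0_ler_powR (ltW a0) p0 ler01 p1; rewrite powR1.
rewrite !bmeanU1//; apply: le_trans (powR_two_point _ _ _ _ a01 p01 _) _.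
  rewrite bmean_ge0//=; apply: ler_bmean => // B.
  by apply: fmono; rewrite subsetUr.
apply: lerD; rewrite ler_wpM2l ?subr_ge0//; apply: IH => // A B AB.
by apply: fmono; rewrite setUS.
Qed.

(* Assigning to each [y] an independent uniform [c y \in S] makes each
   [D] minus the fibre of [c] over [i] a set of bias [1 - 1/#|S|]. *)
Lemma bmean_sum_le (I : finType) (S : {set I}) D (f : I -> {set T} -> R) (K : R) :
  S != set0 ->
  (forall c : T -> I, (forall y, c y \in S) ->
     \sum_(i in S) f i [set y in D | c y != i] <= K) ->
  \sum_(i in S) bmean (1 - #|S|%:R^-1) D (f i) <= K.
Proof.
move=> S0; have Sp : 0 < #|S|%:R :> R by rewrite ltr0n card_gt0.
elim/setU1_ind: D f => [f fK|x D xD IH f fK].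
  have /set0Pn[i0 i0S] := S0.
  have := fK (fun=> i0) (fun=> i0S); congr (_ <= _); apply: eq_bigr => i _.
  by rewrite bmean0; congr (f i _); apply/setP => y; rewrite !inE.
(* [g k] is what [f] becomes once [x] is assigned to class [k]: every set receives [x] except the
   one indexed by [k]. *)
pose g k i B := f i (if i == k then B else x |: B).
have gK k : k \in S -> \sum_(i in S) bmean (1 - #|S|%:R^-1) D (g k i) <= K.
  move=> kS; apply: IH => c cS.
  have := fK (fun y => if y == x then k else c y).
  have -> : (\sum_(i in S) f i [set y in x |: D | (if y == x then k else c y) != i])
     = \sum_(i in S) g k i [set y in D | c y != i].
    apply: eq_bigr => i _; rewrite /g; congr (f i _); apply/setP => y.
    rewrite !inE; have [->|yx] := eqVneq y x.
      rewrite (eq_sym i k); have [_|] := eqVneq k i; rewrite !inE ?eqxx//.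
      by rewrite (negPf xD).
    by case: (i == k); rewrite !inE ?(negPf yx).
  by apply=> y; case: ifP.
have {}gK : \sum_(k in S) \sum_(i in S) bmean (1 - #|S|%:R^-1) D (g k i) <= #|S|%:R * K.
  by rewrite mulr_natl -[leRHS]sumr_const; apply: ler_sum.
(* For fixed [i], summing over [k] omits [x] once ([k = i]) and includes it [#|S| - 1] times, in the
   proportions of the bias. *)
rewrite -(ler_pM2l Sp); apply: le_trans gK; rewrite [leRHS]exchange_big /= mulr_sumr.
apply: ler_sum => i iS; rewrite bmeanU1// (bigD1 i)//= /g eqxx.
rewrite (eq_bigr (fun=> bmean (1 - #|S|%:R^-1) D (fun B => f i (x |: B)))); last first.
  by move=> k /andP[_ ki]; rewrite eq_sym (negPf ki).
rewrite sumr_const.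
have -> : #|[pred k in S | k != i]| = #|S|.-1.
  rewrite (cardsD1 i S) iS /=; apply: eq_card => k.
  by rewrite !inE andbC.
have SE : #|S|%:R = #|S|.-1%:R + 1 :> R by rewrite natr1 prednK// card_gt0.
set u := bmean _ _ _; set v := bmean _ _ _.
rewrite -(mulr_natl u) [#|S|.-1%:R](_ : _ = #|S|%:R - 1); last by rewrite SE addrK.
by rewrite le_eqVlt; apply/orP; left; apply/eqP; field; rewrite gt_eqF.
Qed.

End BiasedMean.

(** * Weighted sums with bounded weights *)

Lemma exists_smallest {R : realDomainType} {I : finType} (a : I -> R) k :
  (k <= #|I|)%N ->
  exists2 S : {set I}, #|S| = k & forall i j, i \in S -> j \notin S -> a i <= a j.
Proof.
elim: k => [_|k IH kI].
  by exists set0 => [|i j]; rewrite ?cards0// inE.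
have [S Sk Sa] := IH (ltnW kI).
have /set0Pn[j0 j0S] : ~: S != set0.
  by rewrite -card_gt0 cardsCs setCK Sk subn_gt0.
rewrite inE in j0S.
pose m := [arg min_(j < j0 | j \notin S) a j]%O.
have [mS mP] : m \notin S /\ forall j, j \notin S -> a m <= a j.
  by rewrite /m; case: Order.TotalTheory.arg_minP.
exists (m |: S) => [|i j]; first by rewrite cardsU1 mS Sk.
rewrite !in_setU1 negb_or => /predU1P[-> /andP[_ jS]|iS /andP[_ jS]].
  exact: mP.
exact: Sa.
Qed.

(* Replacing [w] by [W / k] on the [k] smallest values of [a] and by [0]
   elsewhere only decreases the weighted sum. *)
Lemma weighted_sum_ge {R : realFieldType} {I : finType} (a w : I -> R) k :
  let W := \sum_i w i in
  (0 < k)%N -> (k <= #|I|)%N ->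
  (forall i, 0 <= w i <= W / k%:R) ->
  (forall S : {set I}, #|S| = k -> k%:R <= \sum_(i in S) a i) ->
  W <= \sum_i a i * w i.
Proof.
move=> W k0 kI wW aS; have [S Sk Sa] := exists_smallest a k kI.
have /set0Pn[i0 i0S] : S != set0 by rewrite -card_gt0 Sk.
pose m := [arg max_(i > i0 | i \in S) a i]%O.
have [mS mP] : m \in S /\ forall i, i \in S -> a i <= a m.
  by rewrite /m; case: Order.TotalTheory.arg_maxP.
have k0' : 0 < k%:R :> R by rewrite ltr0n.
have W0 : 0 <= W by apply: sumr_ge0 => i _; case/andP: (wW i).
have Wk0 : 0 <= W / k%:R by rewrite divr_ge0// ltW.
(* Relative to [a m], values are nonpositive on [S] and nonnegative off it, so the new weights lower
   the sum; both total weights are [W], so the shift by [a m] cancels. *)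
have H1 : \sum_(i in S) (a i - a m) * (W / k%:R) <= \sum_i (a i - a m) * w i.
  rewrite [leRHS](bigID (mem S)) /= -[leLHS]addr0; apply: lerD.
    apply: ler_sum => i iS; rewrite ler_wnM2l ?subr_le0 ?mP//.
    by case/andP: (wW i).
  apply: sumr_ge0 => i iS; rewrite mulr_ge0 ?subr_ge0 ?Sa//.
  by case/andP: (wW i).
have E1 : \sum_i (a i - a m) * w i = \sum_i a i * w i - a m * W.
  by rewrite mulr_sumr -sumrB; apply: eq_bigr => i _; rewrite mulrBl.
have E2 : \sum_(i in S) (a i - a m) * (W / k%:R) =
    (\sum_(i in S) a i) * (W / k%:R) - a m * W.
  rewrite -mulr_suml sumrB sumr_const Sk mulrBl; congr (_ - _).
  by rewrite -(mulr_natl (a m)); field; rewrite gt_eqF.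
have H2 : W <= (\sum_(i in S) a i) * (W / k%:R).
  rewrite -[leLHS](divfK (lt0r_neq0 k0')) mulrC ler_wpM2r//; exact: aS.
by rewrite E1 E2 in H1; lra.
Qed.

(** * Biased measures and up-closures *)

Lemma biased_measure_bmean {R : realType} n (p : R) (F : {set {set 'I_n}}) :
  biased_measure p F = bmean p setT (fun B => (B \in F)%:R).
Proof.
rewrite /bmean /biased_measure powersetT cardsT card_ord [RHS](bigID (mem F)) /=.
rewrite [X in _ = _ + X]big1 ?addr0 => [|B /andP[_ /negPf ->]]; last exact: mulr0.
by apply: eq_big => [B|B BF]; rewrite ?inE// BF mulr1.
Qed.

Definition upclosure {T : finType} (F : {set {set T}}) : {set {set T}} :=
  [set B : {set T} | [exists A in F, A \subset B]].

Lemma sub_upclosure {T : finType} (F : {set {set T}}) : F \subset upclosure F.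
Proof. by apply/subsetP => A AF; rewrite inE; apply/exists_inP; exists A. Qed.

Lemma upclosureS {T : finType} (F : {set {set T}}) (A B : {set T}) :
  A \subset B -> A \in upclosure F -> B \in upclosure F.
Proof.
move=> AB; rewrite !inE => /exists_inP[C CF CA].
by apply/exists_inP; exists C => //; exact: subset_trans AB.
Qed.

Lemma upclosure_cross_intersecting n r (F : 'I_r -> {set {set 'I_n}}) :
  cross_intersecting F -> cross_intersecting (fun i => upclosure (F i)).
Proof.
move=> FX A AF.
have /fin_all_exists2[C CF CA] : forall i, exists2 C, C \in F i & C \subset A i.
  by move=> i; have := AF i; rewrite inE => /exists_inP.
have /set0Pn[x /bigcapP xC] := FX C CF.
apply/set0Pn; exists x; apply/bigcapP => i _.
by apply: (subsetP (CA i)); exact: xC.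
Qed.

Section BiasedMeasure.
Context {R : realType} {n : nat}.
Implicit Types (p a : R) (F G : {set {set 'I_n}}).

Lemma biased_measure_ge0 p F : 0 <= p <= 1 -> 0 <= biased_measure p F.
Proof.
by move=> p01; rewrite biased_measure_bmean bmean_ge0// => B; rewrite ler0n.
Qed.

Lemma biased_measure_gt0 p F : 0 < p < 1 -> F != set0 -> 0 < biased_measure p F.
Proof.
move=> /andP[p0 p1] /set0Pn[A AF]; rewrite /biased_measure (bigD1 A)//=.
rewrite ltr_wpDr//; last by rewrite mulr_gt0 ?exprn_gt0 ?subr_gt0.
by apply: sumr_ge0 => B _; rewrite mulr_ge0 ?exprn_ge0 ?subr_ge0 ?ltW.
Qed.

Lemma biased_measureS p F G : 0 <= p <= 1 -> F \subset G ->
  biased_measure p F <= biased_measure p G.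
Proof.
move=> p01 FG; rewrite !biased_measure_bmean ler_bmean// => B.
by rewrite ler_nat; case: (boolP (B \in F)) => // /(subsetP FG) ->.
Qed.

Lemma biased_measure_powR p a F : 0 <= p <= 1 -> 0 < a <= 1 ->
  biased_measure p (upclosure F) `^ a <= biased_measure (p `^ a) (upclosure F).
Proof.
move=> p01 a01; rewrite !biased_measure_bmean.
have a0 : a != 0 by case/andP: a01 => a0 _; rewrite gt_eqF.
set f := fun B => _.
(* An indicator equals its [a]-th power because [a] is nonzero. *)
have {2}-> : f = fun B => f B `^ a.
  apply: boolp.funext => B; rewrite /f.
  by case: (B \in _); rewrite ?powR1 ?powR0.
apply: powR_bmean_le => // A B AB; rewrite /f ler_nat.
by case: (boolP (A \in _)) => // /(upclosureS _ _ _ AB) ->.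
Qed.

(** For [c] with values in [S], no [y] lies in all complements of fibres, since it misses the one
    indexed by [c y]. Hence some complement is not in its family, and at most [#|S| - 1] indicators
    equal 1. *)
Lemma sum_biased_measure_le r (S : {set 'I_r}) (F : 'I_r -> {set {set 'I_n}}) :
  S != set0 -> (forall i, F i != set0) -> cross_intersecting F ->
  \sum_(i in S) biased_measure (1 - #|S|%:R^-1) (F i) <= #|S|%:R - 1 :> R.
Proof.
move=> S0 F0 FX.
under eq_bigr do rewrite biased_measure_bmean.
apply: bmean_sum_le => // c cS; rewrite -natr_sum.
have [/forall_inP all_in|] :=
  boolP [forall i in S, [set y in setT | c y != i] \in F i].
  (* Indices outside [S] get an arbitrary member of their nonempty family. *)
  have /fin_all_exists[A AP] i : exists A, A \in F i /\
      (i \in S -> A = [set y in setT | c y != i]).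
    have [iS|iS] := boolP (i \in S).
      by exists [set y in setT | c y != i]; split => //; exact: all_in.
    by have /set0Pn[A AF] := F0 i; exists A.
  have /set0Pn[y /bigcapP yA] := FX A (fun i => (AP i).1).
  by have := yA (c y) isT; rewrite (AP (c y)).2// !inE eqxx.
rewrite negb_forall_in => /exists_inP[i iS iF].
rewrite (bigD1 i)//= (negPf iF) add0n (cardsD1 i S) iS add1n -natr1 addrK ler_nat.
rewrite -sum1_card [leqRHS](eq_bigl (fun j => (j \in S) && (j != i))).
  by apply: leq_sum => j _; exact: leq_b1.
by move=> j; rewrite !inE andbC.
Qed.

End BiasedMeasure.

(** * Logarithmic bounds *)

Lemma sum_log_biased_measure_ge {R : realType} {n r} (S : {set 'I_r})
    (F : 'I_r -> {set {set 'I_n}}) :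
  let q : R := 1 - #|S|%:R^-1 in
  (1 < #|S|)%N -> (forall i, F i != set0) -> cross_intersecting F ->
  #|S|%:R <= \sum_(i in S) ln (biased_measure q (F i)) / ln q.
Proof.
move=> q S1 F0 FX.
have Sp : 0 < #|S|%:R :> R by rewrite ltr0n ltnW.
have q01 : 0 < q < 1.
  by rewrite subr_gt0 invf_lt1// ltr1n S1 ltrBlDr ltrDl invr_gt0.
have [q0 q1] := andP q01.
have S0 : S != set0 by rewrite -card_gt0 ltnW.
have mu0 i : 0 < biased_measure q (F i) by exact: biased_measure_gt0.
(* AM-GM: the arithmetic mean of the measures is at most [(#|S| - 1) / #|S|], which is [q]. *)
have prod_le : \prod_(i in S) biased_measure q (F i) <= q ^+ #|S|.
  apply: le_trans (leif_AGM _) _ => [i _|]; first exact: ltW.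
  rewrite lerXn2r ?nnegrE ?(ltW q0)//.
    by rewrite divr_ge0 ?(ltW Sp)// sumr_ge0// => i _; exact: ltW.
  rewrite ler_pdivrMr// mulrBl mul1r mulVf ?gt_eqF//.
  exact: sum_biased_measure_le.
rewrite -mulr_suml ler_ndivlMr ?ln_lt0// mulr_natl -lnXn//.
have -> : \sum_(i in S) ln (biased_measure q (F i)) =
    ln (\prod_(i in S) biased_measure q (F i)).
  (* Positivity of the partial products is carried along because [lnM] requires it. *)
  apply: (proj2 (big_rec2 (fun x y => 0 < y /\ x = ln y) _ _)) => [|i x y _ [y0 ->]].
    by split; rewrite ?ln1.
  by rewrite mulr_gt0// lnM ?posrE.
by rewrite ler_ln ?posrE ?exprn_gt0 ?prodr_gt0.
Qed.

Lemma ln_biased_measure_le {R : realType} {n} (p q : R) (F : {set {set 'I_n}}) :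
  0 < p -> p <= q -> q < 1 -> F != set0 ->
  ln (biased_measure p (upclosure F)) <=
    ln (biased_measure q (upclosure F)) / ln q * ln p.
Proof.
move=> p0 pq q1 F0.
have q0 := lt_le_trans p0 pq; have p1 := le_lt_trans pq q1.
have lp : ln p < 0 by rewrite ln_lt0// p0.
have lq : ln q < 0 by rewrite ln_lt0// q0.
(* The exponent that turns bias [p] into bias [q]; it is at most 1 because [p <= q < 1]. *)
pose a := ln q / ln p.
have a0 : 0 < a by rewrite nmulr_rgt0// invr_lt0.
have a1 : a <= 1 by rewrite ler_ndivrMr// mul1r ler_ln.
have qE : q = p `^ a by rewrite /powR gt_eqF// divfK ?lt_eqF// lnK.
have U0 : upclosure F != set0.
  by apply: contraNneq F0 => U0; rewrite -subset0 -U0 sub_upclosure.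
have mp : 0 < biased_measure p (upclosure F) by apply: biased_measure_gt0; rewrite ?p0.
have mq : 0 < biased_measure q (upclosure F) by apply: biased_measure_gt0; rewrite ?q0.
have H : ln (biased_measure p (upclosure F) `^ a) <= ln (biased_measure q (upclosure F)).
  rewrite ler_ln ?posrE ?powR_gt0//.
  by rewrite qE biased_measure_powR ?a0 ?a1// !ltW.
rewrite ln_powR in H.
by rewrite [leRHS]mulrAC -[leRHS]mulrA -invf_div -/a ler_pdivlMr// mulrC.
Qed.

(** * Combination of the bounds *)

Lemma fam_max_ge {R : realType} {r} (x : 'I_r -> R) i : x i <= fam_max x.
Proof. exact: le_bigmax. Qed.

Lemma fam_max_lt {R : realType} {r} (x : 'I_r -> R) c :
  0 < c -> (forall i, x i < c) -> fam_max x < c.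
Proof. by move=> c0 xc; apply/bigmax_ltP. Qed.

Theorem corollary5p3 (R : realType) (r n : nat) (p : 'I_r -> R) :
  (2 <= r)%N ->
  (forall i, 0 < p i < 1) ->
  let q0 := fam_max p in
  let L_ := fun i => - ln (p i) in
  let L := \sum_(i < r) L_ i in
  let s := Num.ceil (1 / (1 - q0)) in
  (s <= r%:Z)%R ->
  fam_max L_ <= L / s%:~R ->
  forall F : 'I_r -> {set {set 'I_n}},
    cross_intersecting F ->
    \prod_(i < r) biased_measure (p i) (F i) <= \prod_(i < r) p i.
Proof.
move=> r2 p01 q0 L_ L s sr maxL F FX.
have p0 i : 0 < p i by case/andP: (p01 i).
have p1 i : p i < 1 by case/andP: (p01 i).
have p01' i : 0 <= p i <= 1 by rewrite !ltW.
have [F0|/forallPn[i /negPn/eqP Fi0]] := boolP [forall i, F i != set0]; last first.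
  rewrite (bigD1 i)//= {1}/biased_measure Fi0 big_set0 mul0r.
  by apply: prodr_ge0 => j _; exact: ltW.
move/forallP in F0.
have q0_gt0 : 0 < q0 := lt_le_trans (p0 (Ordinal r2)) (fam_max_ge p _).
have q0_lt1 : q0 < 1 by apply: fam_max_lt.
have s_ge : 1 / (1 - q0) <= s%:~R by exact: Num.Theory.ceil_ge.
have inv_gt1 : 1 < 1 / (1 - q0).
  by rewrite div1r invf_gt1 ?subr_gt0// ltrBlDr ltrDl.
have s_gt1 : 1 < s by rewrite -(ltr_int R); exact: lt_le_trans s_ge.
(* The ceiling exceeds 1, so it is a natural number [k] with [k >= 2]. *)
move: sr maxL s_ge s_gt1; case: s => // k sr maxL s_ge k1.
rewrite -pmulrn in s_ge maxL; rewrite lez_nat in sr; rewrite ltz_nat in k1.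
have kp : 0 < k%:R :> R by rewrite ltr0n ltnW.
pose q : R := 1 - k%:R^-1.
have q1 : q < 1 by rewrite ltrBlDr ltrDl invr_gt0.
(* The ceiling bound [1 / (1 - q0) <= k] rearranges to [q0 <= 1 - 1 / k]. *)
have pq i : p i <= q.
  apply: le_trans (fam_max_ge p i) _; rewrite /q lerBrDr -lerBrDl -/q0.
  by rewrite -[leLHS]mulr1 ler_pdivrMl// -ler_pdivrMr// subr_gt0.
pose a i := ln (biased_measure q (upclosure (F i))) / ln q.
have U0 i : upclosure (F i) != set0.
  by apply: contraNneq (F0 i) => U0; rewrite -subset0 -U0 sub_upclosure.
have aL : L <= \sum_i a i * L_ i.
  apply: (weighted_sum_ge a L_ k) => [||i|S Sk].
  - exact: ltnW.
  - by rewrite card_ord.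
  - rewrite oppr_ge0 ln_le0 ?(ltW (p1 i))//=.
    exact: le_trans (fam_max_ge L_ i) maxL.
  - rewrite /a /q -Sk; apply: sum_log_biased_measure_ge => //; first by rewrite Sk.
    exact: upclosure_cross_intersecting.
(* As [L_ i = - ln (p i)], the right-hand side is [p i] raised to the power [a i]. *)
have mu_le i : biased_measure (p i) (F i) <= expR (- (a i * L_ i)).
  apply: le_trans (biased_measureS _ _ _ (p01' i) (sub_upclosure _)) _.
  rewrite -[leLHS]lnK ?posrE; last exact: biased_measure_gt0.
  by rewrite ler_expR mulrN opprK ln_biased_measure_le.
apply: (@le_trans _ _ (\prod_i expR (- (a i * L_ i)))).
  by apply: ler_prod => i _; rewrite mu_le biased_measure_ge0.
rewrite -expR_sum sumrN.
have -> : \prod_i p i = expR (- L).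
  by rewrite /L -sumrN expR_sum; apply: eq_bigr => i _; rewrite opprK lnK// posrE.
by rewrite ler_expR lerN2.
Qed.
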